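(* Let $\Delta>0$ and $\mathcal{H}_\Delta=\{\mu\in\mathbb{R}^2:|\mu_1-\mu_2|=\Delta\}$. Let $\pi$ be a strategy that is uniformly efficient on $\mathcal{H}_\Delta$. Then for all $\mu \in \mathcal{H}_\Delta$, $$\liminf_{T\rightarrow \infty} \frac{R_\mu^\pi(T)}{\log T} \geq \frac{1}{2\Delta} .$$
   Context: Two-armed Gaussian bandit with known integer horizon $T$: at each time $t\in\{1,\dots,T\}$ the agent chooses $A_t\in\{1,2\}$ and receives a reward $Z_t\sim\mathcal N(\mu_{A_t},1)$, where successive rewards from each arm are i.i.d. and the two arms are independent. A strategy $\pi$ is a function from past actions and rewards to a distribution over the next action; the horizon is known to the agent, so a strategy may depend on $T$. Expectation under $\mu=(\mu_1,\mu_2)$ is denoted $\mathbb{E}_\mu$. The regret of $\pi$ is $R^\pi_\mu(T) = T \max\{\mu_1, \mu_2\} - \mathbb{E}_\mu\left[\sum_{t=1}^T \mu_{A_t}\right]$. A strategy $\pi$ is uniformly efficient on a set $\mathcal S\subset\mathbb{R}^2$ if for all $\mu\in\mathcal S$ and all $\alpha>0$, $R_\mu^\pi(T)=o(T^\alpha)$ as $T\to\infty$. *)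

(* Defs.v *)
(* Developed over MathComp-Analysis, with an arbitrary R : realType as reals. *)
From HB Require Import structures.
From mathcomp Require Export all_boot all_order all_algebra.
From mathcomp Require Export all_classical all_reals all_analysis.
From mathcomp Require Export measurable_realfun.
Export Order.TTheory GRing.Theory Num.Theory.
Export numFieldNormedType.Exports.

Set Implicit Arguments.
Unset Strict Implicit.
Unset Printing Implicit Defensive.

Local Open Scope classical_set_scope.
Local Open Scope ring_scope.

(* The marginal on Y of the joint law of x ~ P and y ~ k x. *)
Section kbind.
Context d1 d2 (X : measurableType d1) (Y : measurableType d2) (R : realType).
Variables (P : probability X R) (k : R.-pker X ~> Y).

Definition kbind (A : set Y) : \bar R := (\int[P]_x k x A)%E.

Let kbind0 : kbind set0 = 0%E.
Proof. by apply: integral0_eq => x _; rewrite measure0. Qed.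

Let kbind_ge0 A : (0 <= kbind A)%E.
Proof. by apply: integral_ge0. Qed.

Let kbind_sigma_additive : semi_sigma_additive kbind.
Proof.
move=> F mF tF mUF.
rewrite [X in _ --> X](_ : _ = \int[P]_x (\sum_(0 <= i <oo) k x (F i)))%E.
  rewrite integral_nneseries//; last by move=> i; exact: measurable_kernel.
  exact: is_cvg_ereal_nneg_natsum.
apply: eq_integral => x _.
by apply/esym/cvg_lim => //; exact: measure_semi_sigma_additive.
Qed.

HB.instance Definition _ := isMeasure.Build _ _ _ kbind
  kbind0 kbind_ge0 kbind_sigma_additive.

Let kbind_setT : kbind setT = 1%E.
Proof.
rewrite /kbind; under eq_integral do rewrite prob_kernel.
rewrite integral_cst// mul1e; exact: probability_setT.
Qed.

HB.instance Definition _ := Measure_isProbability.Build _ _ _ kbind kbind_setT.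

End kbind.

Section mkcomp_probability.
Context d1 d2 d3 (X : measurableType d1) (Y : measurableType d2)
  (Z : measurableType d3) (R : realType).
Variables (l : R.-pker X ~> Y) (k : R.-pker (X * Y) ~> Z).

Let measurable_mkcomp U : measurable U ->
  measurable_fun [set: X] ((l \; k)%E ^~ U).
Proof. exact: measurable_fun_mkcomp_sfinite. Qed.

HB.instance Definition _ := isKernel.Build _ _ _ _ _ (l \; k)%E
  measurable_mkcomp.

Let mkcomp_setT x : (l \; k)%E x setT = 1%E.
Proof.
rewrite /mkcomp/= /kcomp; under eq_integral do rewrite prob_kernel.
rewrite integral_cst// mul1e; exact: prob_kernel.
Qed.

HB.instance Definition _ := Kernel_isProbability.Build _ _ _ _ _ (l \; k)%E
  mkcomp_setT.

End mkcomp_probability.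

Section bandit.
Variable R : realType.

(* [true] is the first arm and [false] the second one. *)
Definition mean (mu : R * R) (a : bool) : R := if a then mu.1 else mu.2.

(* The first n rounds in chronological order, each as a pair (action, reward). *)
Definition history (n : nat) := (n.-tuple (bool * measurableTypeR R))%type.

Section reward.
Variables (n : nat) (mu : R * R).

Definition reward (ha : history n * bool) :
    {measure set (measurableTypeR R) -> \bar R} :=
  normal_prob (mean mu ha.2) 1.

Let measurable_reward U : measurable U -> measurable_fun setT (reward ^~ U).
Proof.
move=> mU.
have mf : measurable_fun [set: bool] (fun a => normal_prob (mean mu a) 1 U).
  by [].
exact: measurableT_comp mf measurable_snd.
Qed.

HB.instance Definition _ := isKernel.Build _ _ _ _ _ reward measurable_reward.

Let reward_setT x : reward x setT = 1%E.
Proof. exact: probability_setT. Qed.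

HB.instance Definition _ := Kernel_isProbability.Build _ _ _ _ _ reward
  reward_setT.

End reward.

Definition extend n (haz : (history n * bool) * measurableTypeR R) :
  history n.+1 := [tuple of rcons haz.1.1 (haz.1.2, haz.2)].

Lemma measurable_extend n : measurable_fun setT (@extend n).
Proof.
apply/measurable_fun_tnthP => i.
case: (unliftP ord_max i) => [j|] ->.
  rewrite (_ : _ \o _ = (fun h : history n => tnth h j) \o fst \o fst).
    apply: measurableT_comp; last exact: measurable_fst.
    apply: measurableT_comp; last exact: measurable_fst.
    exact: measurable_tnth.
  apply/funext => -[[h a] z] /=.
  rewrite (tnth_nth (true, 0)) [RHS](tnth_nth (true, 0)) lift_max /=.
  by rewrite nth_rcons size_tuple ltn_ord.
rewrite (_ : _ \o _ = fun haz => (haz.1.2, haz.2)).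
  apply: measurable_fun_pair => //.
  exact: measurableT_comp measurable_snd measurable_fst.
apply/funext => -[[h a] z] /=.
by rewrite (tnth_nth (true, 0)) /= nth_rcons size_tuple ltnn eqxx.
Qed.

Definition policy := forall n : nat, R.-pker (history n) ~> bool.

(* The first argument is the horizon, known to the agent. *)
Definition strategy := nat -> policy.

Definition round (p : policy) (mu : R * R) (n : nat) :
    R.-pker (history n) ~> (history n.+1) :=
  (p n \; (reward mu \; kdirac (@measurable_extend n)))%E.

(* The joint law of the first n rounds: conditionally on the past and on the
   chosen action a, the reward is drawn from N(mu_a, 1). This is also the law
   obtained when the rewards are read off from two independent sequences of
   i.i.d. rewards, one for each arm. *)
Fixpoint law (p : policy) (mu : R * R) (n : nat) :
    probability (history n) R :=
  if n is n'.+1 then kbind (law p mu n') (round p mu n')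
  else \d_([tuple] : history 0).

Lemma lawS p mu n (A : set (history n.+1)) : measurable A ->
  law p mu n.+1 A =
  (\int[law p mu n]_h \int[p n h]_a
     normal_prob (mean mu a) 1%R [set z | A [tuple of rcons h (a, z)]])%E.
Proof.
move=> mA /=; apply: eq_integral => h _; apply: eq_integral => a _.
have mf : measurable_fun setT
    (fun z : measurableTypeR R => extend (h, a, z)).
  exact: measurableT_comp (@measurable_extend n) (pair1_measurable (h, a)).
have mhA : measurable [set z : measurableTypeR R | A (extend (h, a, z))].
  by rewrite -[X in measurable X]setTI; exact: mf.
rewrite /= /kcomp /kdirac/= /reward/= -[X in normal_prob _ _ X]setIT.
rewrite -integral_indic//.
Qed.

Definition regret (p : strategy) (mu : R * R) (T : nat) : R :=
  T%:R * Num.max mu.1 mu.2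
  - fine 'E_(law (p T) mu T)[fun h => \sum_(t < T) mean mu (tnth h t).1].

Definition uniformly_efficient (p : strategy) (S : set (R * R)) :=
  forall mu, S mu -> forall alpha : R, 0 < alpha ->
    (fun T => regret p mu T) =o_\oo (fun T => T%:R `^ alpha).

Definition gap_set (Delta : R) : set (R * R) :=
  [set mu | `|mu.1 - mu.2| = Delta].

End bandit.

(* Main.v *)
Require Import Defs.
From HB Require Import structures.
From mathcomp Require Import ring lra.

(** Fix a bandit [mu] with gap [Delta], and reflect both means about the best
    one. In the reflected bandit [lam] the best arm of [mu] keeps its mean, and
    the other arm now leads by the same gap [Delta]; so the bad arm of each
    bandit is the good arm of the other, and only pulls of the bad arm of [mu]
    tell the two apart. If [r] is the total shortfall along a history of
    length [T], measured in [mu], then the shortfall measured in [lam] is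
    [T * Delta - r]: a strategy cannot have small regret on both unless it
    discriminates between them.

    Seen as a statistical test, [r / (T * Delta)] has values in [0, 1], and the
    sum of its two errors is [(R_mu + R_lam) / (T * Delta)]. The sum of the
    errors of any test is at least [exp (- 1 - K)], with [K] the
    Kullback-Leibler divergence between the two laws of the history (lemma
    [testing_error_ge]). A pull of the bad arm moves its mean by [2 * Delta]
    and costs [(2 * Delta)^2 / 2] in divergence and [Delta] in regret, hence
    [K = 2 * Delta * R_mu] and (lemma [regret_tradeoff])
    [[T * Delta * exp (- 1 - 2 * Delta * R_mu) <= R_mu + R_lam.]]
    Uniform efficiency bounds the right-hand side by [T^alpha] for every
    [alpha > 0]; taking logarithms,
    [2 * Delta * R_mu >= (1 - alpha) ln T - O(1)].

    The testing bound rests on the likelihood ratio [exp l] between the laws of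
    the history (lemma [law_change_of_measure]). The log-likelihood ratio [l]
    is unbounded and of no sign. Rather than integrating it, the proof bounds
    it from below by [(1 - exp l_s) / s - (1 + s) * K_path], where [exp l_s] is
    the likelihood ratio towards the bandit displaced by [s] in the opposite
    direction: this is the tangent inequality [1 + l_s <= exp l_s]. Both
    exponentials have integral one, so only nonnegative functions are ever
    integrated, and letting [s] tend to zero loses nothing. *)

Set Implicit Arguments.
Unset Strict Implicit.
Unset Printing Implicit Defensive.

Local Open Scope classical_set_scope.
Local Open Scope ring_scope.

(** * Integration along one round *)

Section kbind_integral.
Context d1 d2 (X : measurableType d1) (Y : measurableType d2) (R : realType).
Variables (P : probability X R) (k : R.-pker X ~> Y).

(** With a one-point source and a kernel that ignores it, [kbind P k] becomes
    a composition of kernels, and [integral_kcomp] applies. *)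
Definition cst_kernel (_ : unit) : {measure set X -> \bar R} := P.

Let measurable_cst_kernel U : measurable U ->
  measurable_fun setT (cst_kernel ^~ U).
Proof. by move=> _; exact: measurable_cst. Qed.

HB.instance Definition _ := isKernel.Build _ _ _ _ R cst_kernel
  measurable_cst_kernel.

Let cst_kernel_setT x : cst_kernel x setT = 1%E.
Proof. exact: probability_setT. Qed.

HB.instance Definition _ := Kernel_isProbability.Build _ _ _ _ R cst_kernel
  cst_kernel_setT.

Definition snd_kernel (ux : unit * X) : {measure set Y -> \bar R} := k ux.2.

Let measurable_snd_kernel U : measurable U ->
  measurable_fun setT (snd_kernel ^~ U).
Proof.
move=> mU; exact: measurableT_comp (measurable_kernel k U mU) measurable_snd.
Qed.

HB.instance Definition _ := isKernel.Build _ _ _ _ R snd_kernel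
  measurable_snd_kernel.

Let snd_kernel_setT x : snd_kernel x setT = 1%E.
Proof. exact: prob_kernel. Qed.

HB.instance Definition _ := Kernel_isProbability.Build _ _ _ _ R snd_kernel
  snd_kernel_setT.

Lemma ge0_integral_kbind f :
  (forall y, (0 <= f y)%E) -> measurable_fun setT f ->
  (\int[kbind P k]_y f y = \int[P]_x \int[k x]_y f y)%E.
Proof.
move=> f0 mf.
rewrite -(integral_kcomp cst_kernel snd_kernel tt f0 mf).
by apply: eq_measure_integral.
Qed.

End kbind_integral.

Section law_integral.
Variable R : realType.

(** The density is a version of the Radon-Nikodym derivative, since both have
    the same integral over every measurable set. *)
Lemma ge0_integral_normal_prob (m s : R) (f : R -> \bar R) :
  (forall x, (0 <= f x)%E) -> measurable_fun setT f ->
  (\int[normal_prob m s]_x f x =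
   \int[lebesgue_measure]_x (f x * (normal_pdf m s x)%:E))%E.
Proof.
move=> f0 mf; have dom := normal_prob_dominates m s.
rewrite -(Radon_Nikodym_SigmaFinite.change_of_variables dom)//.
apply: ae_eq_integral => //.
- apply: emeasurable_funM => //.
  apply: (measurable_int lebesgue_measure).
  exact: Radon_Nikodym_SigmaFinite.f_integrable dom.
- apply: emeasurable_funM => //.
  by apply/measurable_EFinP; exact: measurable_normal_pdf.
- suff : ae_eq lebesgue_measure setT
      (Radon_Nikodym_SigmaFinite.f (normal_prob m s) lebesgue_measure)
      (fun x => (normal_pdf m s x)%:E).
    by apply: filterS => x /= fx Tx; rewrite fx.
  apply: integral_ae_eq => //.
  + exact: Radon_Nikodym_SigmaFinite.f_integrable dom.
  + by apply/measurable_EFinP; exact: measurable_normal_pdf.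
  + by move=> A _ mA; rewrite -(Radon_Nikodym_SigmaFinite.f_integral dom).
Qed.

(** Completing the square in the exponent of the Gaussian density. *)
Lemma ge0_integral_normal_shift (m m' : R) (f : R -> \bar R) :
  (forall x, (0 <= f x)%E) -> measurable_fun setT f ->
  (\int[normal_prob m' 1]_x f x = \int[normal_prob m 1]_x
     (f x * (expR ((m' - m) * (x - m) - (m' - m) ^+ 2 / 2))%:E))%E.
Proof.
move=> f0 mf; rewrite !ge0_integral_normal_prob//; last 2 first.
- by move=> x; rewrite mule_ge0// lee_fin expR_ge0.
- apply: emeasurable_funM => //; apply/measurable_EFinP.
  apply: measurableT_comp => //; apply: measurable_funB => //.
  by apply: measurable_funM => //; exact: measurable_funB.
apply: eq_integral => x _; rewrite -muleA; congr (_ * _)%E.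
rewrite -EFinM; congr (_ %:E).
rewrite !normal_pdfE ?oner_eq0// /normal_fun mulrCA -expRD; congr (_ * expR _).
by rewrite expr1n; field.
Qed.

Lemma ge0_integral_lawS (p : policy R) mu n (f : history R n.+1 -> \bar R) :
  (forall h, (0 <= f h)%E) -> measurable_fun setT f ->
  (\int[law p mu n.+1]_h f h = \int[law p mu n]_h \int[p n h]_a
     \int[normal_prob (mean mu a) 1]_z f (extend (h, a, z)))%E.
Proof.
move=> f0 mf; rewrite ge0_integral_kbind//; apply: eq_integral => h _.
rewrite integral_kcomp//; apply: eq_integral => a _.
rewrite integral_kcomp//; apply: eq_integral => z _.
by rewrite integral_dirac// diracT mul1e.
Qed.

End law_integral.

(** * Likelihood ratios between bandits *)

Section change_of_measure.
Variable R : realType.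

Definition path_sum (g : bool * R -> R) n (h : history R n) : R :=
  \sum_(i < n) g (tnth h i).

Lemma path_sum_extend g n (h : history R n) a z :
  path_sum g (extend (h, a, z)) = path_sum g h + g (a, z).
Proof.
rewrite /path_sum big_ord_recr /=; congr (_ + g _).
  apply: eq_bigr => i _; congr g.
  rewrite (tnth_nth (true, 0)) [RHS](tnth_nth (true, 0)) /=.
  by rewrite nth_rcons size_tuple ltn_ord.
by rewrite (tnth_nth (true, 0)) /= nth_rcons size_tuple ltnn eqxx.
Qed.

(** Since [bool] is discrete, measurability in the reward for each arm
    suffices. *)
Lemma measurable_path_sum g n :
  (forall a, measurable_fun setT (fun z => g (a, z))) ->
  measurable_fun setT (@path_sum g n).
Proof.
move=> mg; apply: measurable_sum => i.
have mg' : measurable_fun setT (fun az : bool * measurableTypeR R => g az).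
  rewrite (_ : (fun az => g az) = fun az =>
      if az.1 then g (true, az.2) else g (false, az.2)); last first.
    by apply/funext => -[[] z].
  apply: measurable_fun_ifT.
  - exact: measurable_fst.
  - exact: measurableT_comp (mg true) measurable_snd.
  - exact: measurableT_comp (mg false) measurable_snd.
apply: (measurableT_comp mg'); exact: measurable_tnth.
Qed.

(** The logarithm of the density of [N(lam_a, 1)] with respect to
    [N(mu_a, 1)]. *)
Definition log_ratio (mu lam : R * R) (az : bool * R) : R :=
  let d := mean lam az.1 - mean mu az.1 in
  d * (az.2 - mean mu az.1) - d ^+ 2 / 2.

(** The Kullback-Leibler divergence between [N(mu_a, 1)] and [N(lam_a, 1)]; it
    depends on the arm only, and takes a round as argument so that it can be
    summed along histories. *)
Definition divergence (mu lam : R * R) (az : bool * R) : R :=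
  (mean lam az.1 - mean mu az.1) ^+ 2 / 2.

Lemma measurable_log_ratio mu lam a :
  measurable_fun setT (fun z => log_ratio mu lam (a, z)).
Proof.
rewrite /log_ratio /=; apply: measurable_funB; last exact: measurable_cst.
by apply: measurable_funM; [exact: measurable_cst|exact: measurable_funB].
Qed.

(** The policy contributes the same factors to both laws, so they cancel in
    the likelihood ratio, which only keeps the rewards. *)
Lemma law_change_of_measure (p : policy R) mu lam n
    (f : history R n -> \bar R) :
  (forall h, (0 <= f h)%E) -> measurable_fun setT f ->
  (\int[law p lam n]_h f h = \int[law p mu n]_h
     (f h * (expR (path_sum (log_ratio mu lam) h))%:E))%E.
Proof.
have mexp m : measurable_fun setT
    (fun h : history R m => (expR (path_sum (log_ratio mu lam) h))%:E).
  apply/measurable_EFinP; apply: measurableT_comp => //.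
  by apply: measurable_path_sum => a; exact: measurable_log_ratio.
elim: n f => [|n IH] f f0 mf.
  apply: eq_integral => h _.
  by rewrite /path_sum big_ord0 expR0 mule1.
rewrite (ge0_integral_lawS p lam f0 mf).
rewrite [RHS](@ge0_integral_lawS R p mu n (fun h =>
  f h * (expR (path_sum (log_ratio mu lam) h))%:E)%E); last 2 first.
- by move=> h; rewrite mule_ge0// lee_fin expR_ge0.
- by apply: emeasurable_funM => //; exact: mexp.
rewrite IH; last 2 first.
- by move=> h; apply: integral_ge0 => a _; apply: integral_ge0.
- rewrite (_ : (fun h => _) = fun h => \int[round p lam n h]_y f y)%E.
    apply: (@measurable_fun_integral_kernel _ _ _ _ _ (round p lam n)) => //.
    exact: measurable_kernel.
  apply/funext => h; rewrite integral_kcomp//; apply: eq_integral => a _.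
  rewrite integral_kcomp//; apply: eq_integral => z _.
  by rewrite integral_dirac// diracT mul1e.
apply: eq_integral => h _.
have mfe a : measurable_fun setT (fun z : R => f (extend (h, a, z))).
  apply: (measurableT_comp mf).
  exact: measurableT_comp (@measurable_extend R n) (pair1_measurable (h, a)).
rewrite -ge0_integralZr//; last by move=> a _; apply: integral_ge0.
apply: eq_integral => a _.
rewrite (ge0_integral_normal_shift (mean mu a))// -ge0_integralZr//.
- apply: eq_integral => z _.
  by rewrite path_sum_extend [in RHS]addrC [in RHS]expRD EFinM muleA.
- apply: (emeasurable_funM (mfe a)); apply/measurable_EFinP.
  by apply: measurableT_comp => //; exact: measurable_log_ratio.
- by move=> z _; rewrite mule_ge0// lee_fin expR_ge0.
Qed.

End change_of_measure.

(** * A lower bound on testing errors *)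

Section testing.
Variable R : realType.

(** Moving the means by [s] times the displacement in the opposite direction
    gives a likelihood ratio that controls the negative of the original
    log-likelihood ratio, up to a deterministic cost per arm. *)
Lemma log_ratio_opposite mu lam s (az : bool * R) :
  log_ratio mu (mu.1 - s * (lam.1 - mu.1), mu.2 - s * (lam.2 - mu.2)) az =
  - s * log_ratio mu lam az + - (s + s ^+ 2) * divergence mu lam az.
Proof.
by case: az => -[] z; rewrite /log_ratio /divergence /mean /=; field.
Qed.

Lemma path_sum_lin g1 g2 (x y : R) n (h : history R n) :
  path_sum (fun az => x * g1 az + y * g2 az) h =
  x * path_sum g1 h + y * path_sum g2 h.
Proof. by rewrite /path_sum big_split /= !mulr_sumr. Qed.

Lemma eq_path_sum g1 g2 n (h : history R n) : g1 =1 g2 ->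
  path_sum g1 h = path_sum g2 h.
Proof. by move=> g12; apply: eq_bigr => i _. Qed.

Lemma path_sum_ge0 g n (h : history R n) : (forall az, 0 <= g az) ->
  0 <= path_sum g h.
Proof. by move=> g0; apply: sumr_ge0. Qed.

(** Here [l] stands for the log-likelihood ratio and [D] for the accumulated
    divergence. The error [t + (1 - t) * expR l] is at least [expR m] with
    [m = min 0 l], and [expR m >= expR c * (1 + m - c)] by convexity. It remains
    to bound [m] from below by quantities of known integral: first
    [m >= l - expR l], then [l >= s^-1 - (1 + s) * D - s^-1 * e_s] from the
    tangent of the exponential at zero. The terms are arranged so that both
    sides are nonnegative when [c <= 0]. *)
Lemma test_error_ge_pointwise (t l D s c : R) : 0 <= t <= 1 -> 0 < s ->
  expR c * (1 - c + s^-1) <=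
  t + ((1 - t) * expR l +
    (expR c * expR l + (expR c * (1 + s) * D +
       expR c / s * expR (- s * l + - (s + s ^+ 2) * D)))).
Proof.
move=> /andP[t0 t1] s0.
set e_s := expR (- s * _ + _).
have Hs : s^-1 - l - (1 + s) * D <= s^-1 * e_s.
  have -> : s^-1 - l - (1 + s) * D =
    s^-1 * (1 + (- s * l + - (s + s ^+ 2) * D)) by field; rewrite gt_eqF.
  by rewrite ler_pM2l ?invr_gt0// expR_ge1Dx.
have [m [Hm1 Hm2]] : exists m, expR m <= t + (1 - t) * expR l /\
    l - expR l <= m.
  have := expR_ge1Dx l; have := expR_gt0 l.
  have [l0|l0] := leP 0 l => el0 el1.
    exists 0; rewrite expR0; split; first by nra.
    by lra.
  have : expR l < 1 by rewrite expR_lt1.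
  by exists l; split; [nra|lra].
have Hc : expR c * (1 + (m - c)) <= expR m.
  by rewrite -[in leRHS](subrK c m) expRD mulrC ler_pM2r ?expR_gt0// expR_ge1Dx.
rewrite addrA; apply: le_trans (lerD (le_trans Hc Hm1) (lexx _)).
have -> : expR c * (1 + (m - c)) + (expR c * expR l +
    (expR c * (1 + s) * D + expR c / s * e_s)) =
  expR c * (1 + (m - c) + expR l + (1 + s) * D + s^-1 * e_s) by ring.
rewrite ler_pM2l ?expR_gt0//; lra.
Qed.

(** A form of the Bretagnolle-Huber inequality, for randomized tests and with
    [expR (- 1)] as constant: integrate [test_error_ge_pointwise] with
    [c = - 1 - K], the value that maximizes [expR c * (- K - c)], which is what
    the integrated bound becomes as [s] tends to zero. *)
Lemma testing_error_ge (p : policy R) mu lam n (t : history R n -> R) (K : R) :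
  (forall h, 0 <= t h <= 1) -> measurable_fun setT t ->
  (\int[law p mu n]_h (path_sum (divergence mu lam) h)%:E = K%:E)%E ->
  ((expR (- 1 - K))%:E <=
   \int[law p mu n]_h (t h)%:E + \int[law p lam n]_h (1 - t h)%:E)%E.
Proof.
move=> t01 mt HK.
have t0 h : 0 <= t h by case/andP: (t01 h).
have t1 h : 0 <= 1 - t h by rewrite subr_ge0; case/andP: (t01 h).
have mL lam' : measurable_fun setT
    (fun h : history R n => expR (path_sum (log_ratio mu lam') h)).
  apply: measurableT_comp => //.
  by apply: measurable_path_sum => a; exact: measurable_log_ratio.
have mD : measurable_fun setT
    (fun h : history R n => path_sum (divergence mu lam) h).
  apply: measurable_path_sum => a; rewrite /divergence /=.
  exact: measurable_cst.
have D0 h : 0 <= path_sum (divergence mu lam) h :> R.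
  by apply: path_sum_ge0 => az; rewrite divr_ge0 ?sqr_ge0.
have K0 : 0 <= K.
  by rewrite -lee_fin -HK; apply: integral_ge0 => h _; rewrite lee_fin.
have P1 q k : (\int[law p q n]_h cst k h = k)%E.
  rewrite integral_cst// -[RHS]mule1; congr (_ * _)%E.
  exact: probability_setT.
have L1 lam' : (\int[law p mu n]_h
    (expR (path_sum (log_ratio mu lam') h))%:E = 1)%E.
  have := @law_change_of_measure _ p mu lam' n (cst 1%E).
  by rewrite P1 => ->//; apply: eq_integral => h _; rewrite mul1e.
have mt1 : measurable_fun setT (fun h => 1 - t h).
  by apply: measurable_funB.
rewrite (@law_change_of_measure _ p mu lam n)//; last exact/measurable_EFinP.
set A := (\int[_]_h (t h)%:E)%E; set B := (\int[_]_h (_ * _))%E.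
set c := - 1 - K.
apply/lee_addgt0Pr => e e0.
(* For this [s] the loss [s * (expR c * K)] is at most [e]. *)
pose s := e / (expR c * (1 + K)).
have cK0 : 0 < expR c * (1 + K) by rewrite mulr_gt0 ?expR_gt0//; lra.
have s0 : 0 < s by rewrite divr_gt0.
pose nu := (mu.1 - s * (lam.1 - mu.1), mu.2 - s * (lam.2 - mu.2)).
have : ((expR c * (1 - c + s^-1))%:E <= A + (B + ((expR c)%:E * 1 +
    ((expR c * (1 + s))%:E * K%:E + (expR c / s)%:E * 1))))%E.
  rewrite -HK -[in X in (_ <= _ + (_ + (X + _)))%E](L1 lam) -(L1 nu).
  have mulk k (g : history R n -> R) : 0 <= k -> (forall h, 0 <= g h) ->
      measurable_fun setT g ->
      (k%:E * \int[law p mu n]_h (g h)%:E =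
      \int[law p mu n]_h (k * g h)%:E)%E.
    move=> k0 g0 mg; under [RHS]eq_integral do rewrite EFinM.
    rewrite ge0_integralZl//; first exact/measurable_EFinP.
    by move=> h _; rewrite lee_fin.
  have addg (g1 g2 : history R n -> R) : (forall h, 0 <= g1 h) ->
      measurable_fun setT g1 -> (forall h, 0 <= g2 h) ->
      measurable_fun setT g2 ->
      (\int[law p mu n]_h (g1 h)%:E + \int[law p mu n]_h (g2 h)%:E =
      \int[law p mu n]_h (g1 h + g2 h)%:E)%E.
    move=> g10 mg1 g20 mg2; under [RHS]eq_integral do rewrite EFinD.
    rewrite ge0_integralD//; try exact/measurable_EFinP.
      by move=> h _; rewrite lee_fin.
    by move=> h _; rewrite lee_fin.
  have ec0 : 0 <= expR c := expR_ge0 c.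
  have ecs0 : 0 <= expR c * (1 + s) by rewrite mulr_ge0//; lra.
  have ecs1 : 0 <= expR c / s by rewrite divr_ge0// ltW.
  have L0 lam' h : 0 <= expR (path_sum (log_ratio mu lam') h) :> R.
    exact: expR_ge0.
  have mM k (g : history R n -> R) : measurable_fun setT g ->
    measurable_fun setT (fun h => k * g h) by move=> mg; exact: measurable_funM.
  rewrite /B; under [in X in (_ <= _ + (X + _))%E]eq_integral do rewrite -EFinM.
  have mBL : measurable_fun setT (fun h => (1 - t h) *
      expR (path_sum (log_ratio mu lam) h)) by exact: measurable_funM.
  have BL0 h : 0 <= (1 - t h) * expR (path_sum (log_ratio mu lam) h).
    exact: mulr_ge0.
  rewrite !mulk// addg//; [|by move=> h; exact: mulr_ge0|exact: mM|
    by move=> h; exact: mulr_ge0|exact: mM].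
  rewrite addg//; [|exact: mM|
    by move=> h; do ?apply: addr_ge0 => //; apply: mulr_ge0|
    by apply: measurable_funD; exact: mM].
  rewrite addg//; [|by move=> h; do ?apply: addr_ge0 => //; apply: mulr_ge0|
    by do ?apply: measurable_funD; exact: mM].
  rewrite /A addg//; [|by move=> h; do ?apply: addr_ge0 => //; apply: mulr_ge0|
    by do ?apply: measurable_funD => //; exact: mM].
  rewrite -[leLHS](P1 mu).
  apply: ge0_le_integral => //.
  - move=> h _; rewrite lee_fin mulr_ge0//.
    by rewrite /c; have := s0; rewrite -invr_gt0; lra.
  - apply/measurable_EFinP; do !apply: measurable_funD => //; exact: mM.
  - move=> h _; rewrite lee_fin.
    rewrite (_ : path_sum (log_ratio mu nu) h =
      - s * path_sum (log_ratio mu lam) h +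
      - (s + s ^+ 2) * path_sum (divergence mu lam) h).
      exact: test_error_ge_pointwise.
    rewrite -path_sum_lin; apply: eq_path_sum => az.
    exact: log_ratio_opposite.
rewrite addeA !mule1 -!EFinM -!EFinD -leeBlDr// -EFinB => H.
rewrite -leeBlDr// -EFinB; apply: le_trans H; rewrite lee_fin.
have -> : expR c * (1 - c + s^-1) -
    (expR c + (expR c * (1 + s) * K + expR c / s)) = expR c - s * (expR c * K).
  by rewrite /c; ring.
rewrite lerD2l lerN2 /s mulrAC ler_pdivrMr// ler_pM2l// ler_pM2l ?expR_gt0//.
by rewrite lerDr.
Qed.

End testing.

(** * Regret and the reflected bandit *)

Section regret.
Variable R : realType.

Definition shortfall (mu : R * R) (az : bool * R) : R :=
  Num.max mu.1 mu.2 - mean mu az.1.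

Lemma shortfall_ge0 mu az : 0 <= shortfall mu az.
Proof.
rewrite /shortfall subr_ge0 /mean; case: az.1.
  by rewrite le_max lexx.
by rewrite le_max lexx orbT.
Qed.

Lemma measurable_path_shortfall mu n :
  measurable_fun setT (@path_sum R (shortfall mu) n).
Proof.
apply: measurable_path_sum => a; rewrite /shortfall /=.
exact: measurable_cst.
Qed.

(** Passing to the shortfall makes the integrand nonnegative; the expected
    sum of the means of the chosen arms is finite because it is bounded. *)
Lemma integral_shortfall (p : strategy R) mu T :
  (\int[law (p T) mu T]_h (path_sum (shortfall mu) h)%:E =
   (regret p mu T)%:E)%E.
Proof.
set M := `|mu.1| + `|mu.2|.
pose X (h : history R T) := \sum_(t < T) mean mu (tnth h t).1.
have mX : measurable_fun setT X.
  apply: (@measurable_path_sum R (fun az => mean mu az.1)) => a /=.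
  exact: measurable_cst.
have iX : (law (p T) mu T).-integrable setT (EFin \o X).
  apply: measurable_bounded_integrable => //.
    by apply: (le_lt_trans (probability_le1 _ _)) => //; rewrite ltry.
  exists (T%:R * M); split; first exact: num_real.
  move=> x Mx h _; apply: le_trans (ltW Mx).
  apply: le_trans (ler_norm_sum _ _ _) _.
  rewrite mulr_natl -[T in leRHS]card_ord -sumr_const; apply: ler_sum => i _.
  by rewrite /mean /M; case: ifP => _; rewrite ?lerDl ?lerDr.
have cT k : (\int[law (p T) mu T]_h cst k%:E h = k%:E)%E.
  rewrite integral_cst// -[RHS]mule1; congr (_ * _)%E.
  exact: probability_setT.
have ic k : (law (p T) mu T).-integrable setT (EFin \o cst k).
  exact: finite_measure_integrable_cst.
rewrite (_ : (fun h => _) =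
    fun h => ((T%:R * Num.max mu.1 mu.2)%:E - (X h)%:E)%E); last first.
  apply/funext => h; rewrite -EFinB /path_sum sumrB sumr_const card_ord.
  by rewrite mulr_natl.
rewrite (integralB_EFin _ (ic _) iX)// cT /regret EFinB; congr (_ - _)%E.
rewrite unlock fineK//; exact: integrable_fin_num.
Qed.

(** The best mean is kept, and the other one passes to its mirror image
    above. *)
Definition reflect_mean (mu : R * R) : R * R :=
  (Num.max mu.1 mu.2 *+ 2 - mu.1, Num.max mu.1 mu.2 *+ 2 - mu.2).

Lemma gap_set_reflect_mean Delta mu :
  gap_set Delta mu -> gap_set Delta (reflect_mean mu).
Proof.
rewrite /gap_set /reflect_mean /= => <-; rewrite -normrN; congr `|_|; ring.
Qed.

Lemma max_reflect_mean Delta mu : gap_set Delta mu ->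
  Num.max (reflect_mean mu).1 (reflect_mean mu).2 = Num.max mu.1 mu.2 + Delta.
Proof.
rewrite /gap_set /reflect_mean /= => <-.
case: (leP mu.1 mu.2) => m12.
  by rewrite max_l ?ler0_norm; lra.
by rewrite max_r ?gtr0_norm; lra.
Qed.

Lemma shortfall_reflect_mean Delta mu az : gap_set Delta mu ->
  shortfall (reflect_mean mu) az = Delta - shortfall mu az.
Proof.
move=> gmu; rewrite /shortfall (max_reflect_mean gmu) /mean /=.
by case: az.1; ring.
Qed.

(** The divergence of an arm is [2 * g ^+ 2] with [g] its shortfall, and [g] is
    [0] or [Delta]. *)
Lemma divergence_reflect_mean Delta mu az : gap_set Delta mu ->
  divergence mu (reflect_mean mu) az = 2 * Delta * shortfall mu az.
Proof.
rewrite /gap_set /reflect_mean /shortfall /divergence /mean /= => <-.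
case: (leP mu.1 mu.2) => m12.
  by rewrite ler0_norm ?subr_le0//; case: az.1 => /=; field.
by rewrite gtr0_norm ?subr_gt0//; case: az.1 => /=; field.
Qed.

(** The normalized shortfall in [mu] is the test to which [testing_error_ge]
    is applied: its two errors are the two regrets. *)
Lemma regret_tradeoff Delta (p : strategy R) mu T : 0 < Delta -> (0 < T)%N ->
  gap_set Delta mu ->
  T%:R * Delta * expR (- 1 - 2 * Delta * regret p mu T) <=
  regret p mu T + regret p (reflect_mean mu) T.
Proof.
move=> D0 T0 gmu; set lam := reflect_mean mu; set N := T%:R * Delta.
have N0 : 0 < N by rewrite mulr_gt0// ltr0n.
pose t (h : history R T) := N^-1 * path_sum (shortfall mu) h.
have sumN (h : history R T) : path_sum (shortfall lam) h =
    N - path_sum (shortfall mu) h.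
  rewrite /path_sum /N mulr_natl -[T in _ *+ T]card_ord -sumr_const -sumrB.
  by apply: eq_bigr => i _; exact: shortfall_reflect_mean.
have t1E h : 1 - t h = N^-1 * path_sum (shortfall lam) h.
  by rewrite sumN mulrBr mulVf ?gt_eqF.
have t01 h : 0 <= t h <= 1.
  rewrite -subr_ge0 t1E !mulr_ge0// ?invr_ge0 ?(ltW N0)//;
    by apply: path_sum_ge0 => az; exact: shortfall_ge0.
have intE mu' : (\int[law (p T) mu' T]_h
    (N^-1 * path_sum (shortfall mu') h)%:E = (N^-1 * regret p mu' T)%:E)%E.
  under eq_integral do rewrite EFinM.
  rewrite ge0_integralZl//.
  - by rewrite integral_shortfall.
  - by apply/measurable_EFinP; exact: measurable_path_shortfall.
  - by move=> h _; rewrite lee_fin path_sum_ge0// => az; exact: shortfall_ge0.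
  - by rewrite lee_fin invr_ge0 ltW.
have mt : measurable_fun setT t.
  apply: measurable_funM; first exact: measurable_cst.
  exact: measurable_path_shortfall.
have HK : (\int[law (p T) mu T]_h (path_sum (divergence mu lam) h)%:E =
    (2 * Delta * regret p mu T)%:E)%E.
  rewrite EFinM -integral_shortfall -ge0_integralZl//.
  - apply: eq_integral => h _; rewrite -EFinM; congr (_ %:E).
    rewrite /path_sum mulr_sumr; apply: eq_bigr => i _.
    exact: divergence_reflect_mean.
  - by apply/measurable_EFinP; exact: measurable_path_shortfall.
  - by move=> h _; rewrite lee_fin path_sum_ge0// => az; exact: shortfall_ge0.
  - by rewrite lee_fin mulr_ge0// ltW.
have := testing_error_ge t01 mt HK.
under [X in (_ <= _ + X)%E]eq_integral do rewrite t1E.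
by rewrite !intE -EFinD lee_fin -mulrDr ler_pdivlMl.
Qed.

End regret.

(** * The asymptotic bound *)

Lemma near_le_limn_einf (R : realType) (u : (\bar R)^nat) (l : \bar R) :
  (\forall n \near \oo, (l <= u n)%E) -> (l <= limn_einf u)%E.
Proof.
move=> [N _ lu]; rewrite limn_einf_lim; apply: lime_ge.
  exact: is_cvg_einfs.
exists N => // n /= Nn; apply: le_ereal_inf_tmp => _ [m /= nm <-].
by apply: lu; exact: leq_trans Nn nm.
Qed.

Theorem theorem6 (R : realType) (Delta : R) (pi : strategy R) :
  0 < Delta ->
  uniformly_efficient pi (gap_set Delta) ->
  forall mu : R * R, gap_set Delta mu ->
    ((1 / (2 * Delta))%:E <=
       limn_einf (fun T : nat => (regret pi mu T / ln (T%:R : R))%:E))%E.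
Proof.
move=> D0 eff mu gmu; apply/lee_addgt0Pr => e e0.
(* The slack [e] in the conclusion is a slack [2 * Delta * e] in the factor of
   [ln T]; half of it pays for [T^alpha], half for the additive constant. *)
rewrite -leeBlDr// -EFinB; apply: near_le_limn_einf.
have a0 : 0 < e * Delta by rewrite mulr_gt0.
have half0 : 0 < 2^-1 :> R by rewrite invr_gt0.
have /eqoP/(_ _ half0) near_mu := eff _ gmu _ a0.
have /eqoP/(_ _ half0) near_lam := eff _ (gap_set_reflect_mean gmu) _ a0.
near=> T.
have T1 : (1 < T)%N by near: T; exists 2%N.
have T0 : 0 < T%:R :> R by rewrite ltr0n ltnW.
have lnT0 : 0 < ln (T%:R : R) by rewrite ln_gt0// ltr1n.
have lnT : 1 - ln Delta <= e * Delta * ln T%:R.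
  rewrite mulrC -ler_pdivrMr// -[leLHS]expRK ler_ln ?posrE ?expR_gt0//.
  by near: T; exact: nbhs_infty_ger.
have Rmu : regret pi mu T <= 2^-1 * T%:R `^ (e * Delta).
  apply: le_trans (ler_norm _) _.
  rewrite -[X in _ <= _ * X]ger0_norm ?powR_ge0//; near: T; exact: near_mu.
have Rlam : regret pi (reflect_mean mu) T <= 2^-1 * T%:R `^ (e * Delta).
  apply: le_trans (ler_norm _) _.
  rewrite -[X in _ <= _ * X]ger0_norm ?powR_ge0//; near: T; exact: near_lam.
have : T%:R * Delta * expR (- 1 - 2 * Delta * regret pi mu T) <=
    T%:R `^ (e * Delta).
  apply: le_trans (regret_tradeoff pi D0 (ltnW T1) gmu) _; lra.
rewrite -ler_ln; first last.
- by rewrite posrE powR_gt0.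
- by rewrite posrE mulr_gt0 ?mulr_gt0 ?expR_gt0.
rewrite ln_powR !lnM ?posrE ?mulr_gt0 ?expR_gt0// expRK => ineq.
rewrite lee_fin ler_pdivlMr// mulrBl div1r mulrC lerBlDr.
rewrite ler_pdivrMr; last by rewrite mulr_gt0.
lra.
Unshelve. all: by end_near.
Qed.
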